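(* Let $\Lambda\in\mathcal G$ be a fixed graph. Then: (i) $\mathtt{GC}^{\mathrm{hom}}(\Lambda)$ is a character over $(\langle\mathcal G\rangle_{\mathbb Q},\cdot_{\mathrm{hom}})$, i.e. $\langle\mathtt{GC}^{\mathrm{hom}}(\Lambda),\sigma_1\rangle\cdot\langle\mathtt{GC}^{\mathrm{hom}}(\Lambda),\sigma_2\rangle=\langle\mathtt{GC}^{\mathrm{hom}}(\Lambda),\sigma_1\cdot_{\mathrm{hom}}\sigma_2\rangle$; (ii) $\mathtt{GC}^{\mathrm{mono}}(\Lambda)$ is a character over $(\langle\mathcal G\rangle_{\mathbb Q},\cdot_{\mathrm{mono}})$, i.e. $\langle\mathtt{GC}^{\mathrm{mono}}(\Lambda),\sigma_1\rangle\cdot\langle\mathtt{GC}^{\mathrm{mono}}(\Lambda),\sigma_2\rangle=\langle\mathtt{GC}^{\mathrm{mono}}(\Lambda),\sigma_1\cdot_{\mathrm{mono}}\sigma_2\rangle$; (iii) $\mathtt{GC}^{\mathrm{regmono}}(\Lambda)$ is a character over $(\langle\mathcal G\rangle_{\mathbb Q},\cdot_{\mathrm{regmono}})$, i.e. $\langle\mathtt{GC}^{\mathrm{regmono}}(\Lambda),\sigma_1\rangle\cdot\langle\mathtt{GC}^{\mathrm{regmono}}(\Lambda),\sigma_2\rangle=\langle\mathtt{GC}^{\mathrm{regmono}}(\Lambda),\sigma_1\cdot_{\mathrm{regmono}}\sigma_2\rangle$; for all $\sigma_1,\sigma_2\in\langle\mathcal G\rangle_{\mathbb Q}$.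
   Context: Graphs are finite simple graphs (isolated vertices allowed, no loops, no parallel edges); $\mathsf e$ is the empty graph. $\mathrm{Hom}(\sigma,\tau)$ is the set of graph homomorphisms (maps $V(\sigma)\to V(\tau)$ sending edges to edges); $\mathrm{Mono}(\sigma,\tau)$ those injective on vertices (monomorphisms); $\mathrm{RegMono}(\sigma,\tau)$ those that are isomorphisms onto the subgraph of $\tau$ induced by the image of $V(\sigma)$ (regular monomorphisms); $\mathrm{Epi}(\sigma,\tau)$ those surjective on vertices; $\mathrm{RegEpi}(\sigma,\tau)$ those surjective on vertices and on edges. $\mathrm{Aut}(\sigma)$ is the automorphism group. $\mathcal G$ is the set of isomorphism classes of graphs and $\langle\mathcal G\rangle_{\mathbb Q}$ the $\mathbb Q$-vector space with basis $\mathcal G$. Products (bilinear, with unit $\mathsf e$), where $\sqcup$ is disjoint union and $\sigma_1,\sigma_2\in\mathcal G$: $\sigma_1\cdot_{\mathrm{hom}}\sigma_2=\sigma_1\sqcup\sigma_2$; $$\sigma_1\cdot_{\mathrm{mono}}\sigma_2=\sum_{\gamma\in\mathcal G}\frac{|\{f\in\mathrm{RegEpi}(\sigma_1\sqcup\sigma_2,\gamma): f|_{\sigma_1},f|_{\sigma_2}\text{ are monomorphisms}\}|}{|\mathrm{Aut}(\gamma)|}\,\gamma;$$ $$\sigma_1\cdot_{\mathrm{regmono}}\sigma_2=\sum_{\gamma\in\mathcal G}\frac{|\{f\in\mathrm{Epi}(\sigma_1\sqcup\sigma_2,\gamma): f|_{\sigma_1},f|_{\sigma_2}\text{ are regular monomorphisms}\}|}{|\mathrm{Aut}(\gamma)|}\,\gamma.$$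 For a graph $\Lambda$, $\mathtt{GC}^{\mathrm{hom}}(\Lambda),\mathtt{GC}^{\mathrm{mono}}(\Lambda),\mathtt{GC}^{\mathrm{regmono}}(\Lambda)$ are the linear functionals on $\langle\mathcal G\rangle_{\mathbb Q}$ whose values at $\sigma\in\mathcal G$ are $|\mathrm{Hom}(\sigma,\Lambda)|$, $|\mathrm{Mono}(\sigma,\Lambda)|$, $|\mathrm{RegMono}(\sigma,\Lambda)|$ respectively; $\langle f,x\rangle$ denotes the value of the functional $f$ at $x$. *)

(* Defs.v *)
From HB Require Import structures.
From mathcomp Require Export all_boot all_order all_algebra.
From mathcomp.multinomials Require Export freeg.

Set Implicit Arguments.
Unset Strict Implicit.
Unset Printing Implicit Defensive.

Import GRing.Theory.
Local Open Scope ring_scope.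
Local Open Scope quotient_scope.

Record sgraph := SGraph {
  vertex :> finType;
  adj : rel vertex;
  adj_sym : symmetric adj;
  adj_irr : irreflexive adj }.

Arguments adj {s} x y.

Section Maps.
Implicit Types s t : sgraph.

Definition vertex_surjective s t (f : {ffun s -> t}) : bool :=
  [forall v, exists x, f x == v].

Definition edge_surjective s t (f : {ffun s -> t}) : bool :=
  [forall u, forall v, adj u v ==>
    [exists x, exists y, [&& adj x y, f x == u & f y == v]]].

Definition Hom s t : {set {ffun s -> t}} :=
  [set f : {ffun s -> t} | [forall x, forall y, adj x y ==> adj (f x) (f y)]].

Definition Mono s t : {set {ffun s -> t}} :=
  [set f in Hom s t | injectiveb f].

Definition Epi s t : {set {ffun s -> t}} :=
  [set f in Hom s t | vertex_surjective f].

Definition RegEpi s t : {set {ffun s -> t}} :=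
  [set f in Epi s t | edge_surjective f].

Definition Iso s t : {set {ffun s -> t}} :=
  [set f : {ffun s -> t} | [&& injectiveb f, vertex_surjective f &
     [forall x, forall y, adj (f x) (f y) == adj x y]]].

Definition Aut s : {set {ffun s -> s}} := Iso s s.

Definition isog s t : bool := [exists f, f \in Iso s t].

End Maps.

Section Induced.
Variables (t : sgraph) (S : {set t}).

Definition induced_adj : rel {x : t | x \in S} := fun x y => adj (val x) (val y).

Lemma induced_sym : symmetric induced_adj.
Proof. by move=> x y; rewrite /induced_adj adj_sym. Qed.

Lemma induced_irr : irreflexive induced_adj.
Proof. by move=> x; rewrite /induced_adj adj_irr. Qed.

Definition induced : sgraph := SGraph induced_sym induced_irr.

End Induced.

(* The corestriction g of f to its image is an isomorphism onto the induced
   subgraph; see RegMonoE for the pointwise form. *)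
Definition RegMono (s t : sgraph) : {set {ffun s -> t}} :=
  [set f : {ffun s -> t} |
    [exists g : {ffun s -> induced (f @: [set: s])},
       (g \in Iso s (induced (f @: [set: s]))) &&
       [forall x, f x == val (g x)]]].

Lemma RegMonoE (s t : sgraph) (f : {ffun s -> t}) :
  (f \in RegMono s t) =
  injectiveb f && [forall x, forall y, adj (f x) (f y) == adj x y].
Proof.
rewrite inE; apply/existsP/andP.
- case=> g /andP [+ /forallP fE]; rewrite inE => /and3P [/injectiveP gi _ gA].
  have {}fE x : f x = val (g x) by apply/eqP.
  split; first by apply/injectiveP => x y; rewrite !fE => /val_inj /gi.
  apply/forallP => x; apply/forallP => y.
  by move/forallP: gA => /(_ x) /forallP /(_ y); rewrite !fE.
- case=> /injectiveP fi fA.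
  have fin x : f x \in f @: [set: s] by apply/imset_f.
  exists [ffun x => exist _ (f x) (fin x)]; apply/andP; split; last first.
    by apply/forallP => x; rewrite ffunE.
  rewrite inE; apply/and3P; split.
  + by apply/injectiveP => x y; rewrite !ffunE => -[] /fi.
  + apply/forallP => -[v vin]; apply/existsP; case/imsetP: (vin) => x _ vE.
    by exists x; rewrite ffunE -val_eqE /= vE.
  + apply/forallP => x; apply/forallP => y; rewrite !ffunE.
    by move/forallP: fA => /(_ x) /forallP /(_ y).
Qed.

Lemma isog_refl : reflexive isog.
Proof.
move=> s; apply/existsP; exists [ffun x => x]; rewrite inE; apply/and3P; split.
- by apply/injectiveP => x y; rewrite !ffunE.
- by apply/forallP => v; apply/existsP; exists v; rewrite ffunE.
- by apply/forallP => x; apply/forallP => y; rewrite !ffunE.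
Qed.

Lemma isog_trans : transitive isog.
Proof.
move=> t s u /existsP [f +] /existsP [g +]; rewrite !inE.
move=> /and3P [/injectiveP fi /forallP fs /forallP fA].
move=> /and3P [/injectiveP gi /forallP gs /forallP gA].
apply/existsP; exists [ffun x => g (f x)]; rewrite inE; apply/and3P; split.
- by apply/injectiveP => x y; rewrite !ffunE => /gi /fi.
- apply/forallP => v; case/existsP: (gs v) => y /eqP <-.
  by case/existsP: (fs y) => x /eqP <-; apply/existsP; exists x; rewrite ffunE.
- apply/forallP => x; apply/forallP => y; rewrite !ffunE.
  by rewrite (eqP (forallP (gA _) _)) (eqP (forallP (fA _) _)).
Qed.

Lemma isog_sym : symmetric isog.
Proof.
suff H s t : isog s t -> isog t s by move=> s t; apply/idP/idP; apply: H.
case/existsP => f; rewrite inE => /and3P [/injectiveP fi /forallP fs /forallP fA].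
pose g v := xchoose (existsP (fs v)).
have fgK v : f (g v) = v by apply/eqP/(xchooseP (existsP (fs v))).
apply/existsP; exists [ffun v => g v]; rewrite inE; apply/and3P; split.
- by apply/injectiveP => x y; rewrite !ffunE => /(congr1 f); rewrite !fgK.
- apply/forallP => x; apply/existsP; exists (f x); rewrite ffunE.
  by apply/eqP/fi; rewrite fgK.
- apply/forallP => x; apply/forallP => y; rewrite !ffunE.
  by rewrite -(eqP (forallP (fA _) _)) !fgK.
Qed.

Section DisjointUnion.
Variables s1 s2 : sgraph.

Definition union_adj : rel (s1 + s2)%type := fun x y =>
  match x, y with
  | inl a, inl b => adj a b
  | inr a, inr b => adj a b
  | _, _ => false
  end.

Lemma union_sym : symmetric union_adj.
Proof. by case=> a [] b //=; rewrite adj_sym. Qed.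

Lemma union_irr : irreflexive union_adj.
Proof. by case=> a /=; rewrite adj_irr. Qed.

Definition disjoint_union : sgraph := SGraph union_sym union_irr.

Definition restrl t (f : {ffun disjoint_union -> t}) : {ffun s1 -> t} :=
  [ffun x : s1 => f (inl x)].

Definition restrr t (f : {ffun disjoint_union -> t}) : {ffun s2 -> t} :=
  [ffun x : s2 => f (inr x)].

End DisjointUnion.

Definition empty_graph : sgraph :=
  @SGraph void (fun _ _ => false) (fun _ _ => erefl) (fun _ => erefl).

(* Graphs with vertex set {0, ..., n-1}: a choiceType containing every finite
   graph up to isomorphism, so that isomorphism classes form a quotType. *)
Definition edge_setb n (E : {set 'I_n * 'I_n}) : bool :=
  [forall x, forall y, ((x, y) \in E) ==> (x != y) && ((y, x) \in E)].

Definition edge_set (n : nat) : Type := {E : {set 'I_n * 'I_n} | edge_setb E}.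

HB.instance Definition _ n := Finite.on (edge_set n).

Definition lgraph : Type := {n : nat & edge_set n}.

HB.instance Definition _ := Choice.on lgraph.

Section OfLgraph.
Variable c : lgraph.

Definition lgraph_adj : rel 'I_(tag c) := fun x y => (x, y) \in val (tagged c).

Lemma lgraph_sym : symmetric lgraph_adj.
Proof.
move=> x y; have /forallP H := valP (tagged c); apply/idP/idP => h.
- by have /forallP /(_ y) /implyP /(_ h) /andP [] := H x.
- by have /forallP /(_ x) /implyP /(_ h) /andP [] := H y.
Qed.

Lemma lgraph_irr : irreflexive lgraph_adj.
Proof.
move=> x; apply/negP => h; have /forallP /(_ x) /forallP /(_ x) := valP (tagged c).
by move/implyP => /(_ h); rewrite eqxx.
Qed.

Definition sgraph_of_lgraph : sgraph := SGraph lgraph_sym lgraph_irr.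

End OfLgraph.

Section ToLgraph.
Variable s : sgraph.

Definition enum_edges : {set 'I_#|s| * 'I_#|s|} :=
  [set p | adj (enum_val p.1) (enum_val p.2)].

Lemma enum_edgesP : edge_setb enum_edges.
Proof.
apply/forallP => x; apply/forallP => y; apply/implyP; rewrite !inE /= => h.
rewrite adj_sym h andbT; apply/eqP => xy; move: h.
by rewrite xy adj_irr.
Qed.

Definition lgraph_of_sgraph : lgraph :=
  Tagged edge_set (exist _ enum_edges enum_edgesP : edge_set #|s|).

Lemma lgraph_of_sgraphK : isog (sgraph_of_lgraph lgraph_of_sgraph) s.
Proof.
apply/existsP; exists [ffun i : 'I_#|s| => enum_val i]; rewrite inE.
apply/and3P; split.
- by apply/injectiveP => x y; rewrite !ffunE => /enum_val_inj.
- apply/forallP => v; apply/existsP; exists (enum_rank v).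
  by rewrite ffunE enum_rankK.
- apply/forallP => x; apply/forallP => y; rewrite !ffunE.
  by rewrite /= /lgraph_adj /= inE.
Qed.

End ToLgraph.

Definition lisog : rel lgraph := fun c d =>
  isog (sgraph_of_lgraph c) (sgraph_of_lgraph d).

Lemma lisog_refl : reflexive lisog. Proof. by move=> c; apply: isog_refl. Qed.
Lemma lisog_sym : symmetric lisog. Proof. by move=> c d; apply: isog_sym. Qed.
Lemma lisog_trans : transitive lisog.
Proof. by move=> d c e; apply: isog_trans. Qed.

Canonical lisog_equiv := EquivRel lisog lisog_refl lisog_sym lisog_trans.

Definition graph_class : Type := {eq_quot lisog}.

HB.instance Definition _ := Choice.on graph_class.

(* A chosen representative of an isomorphism class. *)
Definition rep (g : graph_class) : sgraph :=
  sgraph_of_lgraph (repr (g : {eq_quot lisog})).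

Coercion rep : graph_class >-> sgraph.

Definition class_of (s : sgraph) : graph_class :=
  \pi_({eq_quot lisog}) (lgraph_of_sgraph s).

Lemma rep_class_of s : isog (rep (class_of s)) s.
Proof.
apply: isog_trans (lgraph_of_sgraphK s).
have /eqmodP := reprK (class_of s : {eq_quot lisog}); exact.
Qed.

Lemma class_of_rep (g : graph_class) : class_of (rep g) = g.
Proof.
rewrite -[RHS](reprK (g : {eq_quot lisog})); apply/eqmodP.
exact: lgraph_of_sgraphK.
Qed.

Lemma class_ofP s t : class_of s = class_of t <-> isog s t.
Proof.
split=> [st|st].
- apply: (isog_trans _ (rep_class_of t)).
  by rewrite -st isog_sym rep_class_of.
- apply/eqmodP; apply: (isog_trans (lgraph_of_sgraphK s)).
  by apply: (isog_trans st); rewrite isog_sym lgraph_of_sgraphK.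
Qed.

(* Duplicate-free enumeration of the classes of graphs with at most N vertices. *)
Definition classes_upto (N : nat) : seq graph_class :=
  undup (flatten [seq
    [seq \pi_({eq_quot lisog}) (Tagged edge_set E) | E <- enum {: edge_set n}]
    | n <- iota 0 N.+1]).

Lemma isog_card s t : isog s t -> #|s| = #|t|.
Proof.
suff H (u v : sgraph) : isog u v -> (#|u| <= #|v|)%N.
  by move=> st; apply/eqP; rewrite eqn_leq !H // isog_sym.
case/existsP => f; rewrite inE => /and3P [/injectiveP fi _ _].
exact: leq_card fi.
Qed.

Lemma mem_classes_upto N (g : graph_class) :
  (g \in classes_upto N) = (#|g| <= N)%N.
Proof.
rewrite mem_undup; apply/flatten_mapP/idP.
- case=> n; rewrite mem_iota add0n ltnS => nN /mapP [E _ gE].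
  suff /isog_card -> : isog (rep g) (sgraph_of_lgraph (Tagged edge_set E)).
    by rewrite card_ord.
  rewrite /rep; apply/(@eqmodP _ lisog_equiv); by rewrite reprK gE.
- rewrite /rep; set c := repr _ => cN; exists (tag c).
    by rewrite mem_iota add0n ltnS; move: cN; rewrite card_ord.
  apply/mapP; exists (tagged c); first by rewrite mem_enum.
  by rewrite taggedK reprK.
Qed.

Definition QG := {freeg graph_class / rat}.

Definition bilinear_ext (m : graph_class -> graph_class -> QG) (x y : QG) : QG :=
  fglift (fun s1 => fglift (m s1) y) x.

Definition hom_prod (s1 s2 : graph_class) : QG :=
  << class_of (disjoint_union s1 s2) >>.

Definition mono_coef (s1 s2 g : graph_class) : rat :=
  #|[set f in RegEpi (disjoint_union s1 s2) g |
      (restrl f \in Mono s1 g) && (restrr f \in Mono s2 g)]|%:R / #|Aut g|%:R.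

Definition regmono_coef (s1 s2 g : graph_class) : rat :=
  #|[set f in Epi (disjoint_union s1 s2) g |
      (restrl f \in RegMono s1 g) && (restrr f \in RegMono s2 g)]|%:R
  / #|Aut g|%:R.

(* The sums over all isomorphism classes have finite support: the coefficient of
   g vanishes when g has more than |s1| + |s2| vertices; see coeff_mono_prod and
   coeff_regmono_prod. *)
Definition mono_prod (s1 s2 : graph_class) : QG :=
  \sum_(g <- classes_upto (#|s1| + #|s2|)) << mono_coef s1 s2 g *g g >>.

Definition regmono_prod (s1 s2 : graph_class) : QG :=
  \sum_(g <- classes_upto (#|s1| + #|s2|)) << regmono_coef s1 s2 g *g g >>.

Lemma card_Epi_union s1 s2 t f :
  f \in Epi (disjoint_union s1 s2) t -> (#|t| <= #|s1| + #|s2|)%N.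
Proof.
rewrite inE => /andP [_ /forallP fs]; rewrite -card_sum.
rewrite -cardsT; apply: (@leq_trans #|f @: [set: disjoint_union s1 s2]|).
  apply/subset_leq_card/subsetP => v _; case/existsP: (fs v) => x /eqP <-.
  exact: imset_f.
by apply: (leq_trans (leq_imset_card _ _)); rewrite cardsT.
Qed.

Lemma coeff_classes_sum (c : graph_class -> rat) N (g : graph_class) :
  (c g != 0 -> (#|g| <= N)%N) ->
  coeff g (\sum_(h <- classes_upto N) << c h *g h >>) = c g.
Proof.
move=> cN; rewrite raddf_sum /=; under eq_bigr do rewrite coeffU.
case: (boolP (g \in classes_upto N)) => gN.
  rewrite (bigD1_seq g) ?undup_uniq //= eqxx mulr1 big1 ?addr0 // => h hg.
  by rewrite (negbTE hg) mulr0.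
rewrite big1_seq => [|h /= hN].
  by apply/esym/eqP; apply: contraNT gN => /cN; rewrite mem_classes_upto.
case: eqP hN => [->|_ _]; last by rewrite mulr0.
by rewrite (negbTE gN).
Qed.

Lemma coeff_mono_prod (s1 s2 g : graph_class) :
  coeff g (mono_prod s1 s2) = mono_coef s1 s2 g.
Proof.
apply: coeff_classes_sum; apply: contraNT => gN; rewrite /mono_coef.
set A := [set f in _ | _]; suff -> : A = set0 by rewrite cards0 mul0r.
apply/setP => f; rewrite in_set0 in_set; apply/negP => /andP [].
by rewrite inE => /andP [/card_Epi_union fE _] _; rewrite fE in gN.
Qed.

Lemma coeff_regmono_prod (s1 s2 g : graph_class) :
  coeff g (regmono_prod s1 s2) = regmono_coef s1 s2 g.
Proof.
apply: coeff_classes_sum; apply: contraNT => gN; rewrite /regmono_coef.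
set A := [set f in _ | _]; suff -> : A = set0 by rewrite cards0 mul0r.
apply/setP => f; rewrite in_set0 in_set; apply/negP => /andP [].
by move/card_Epi_union => fE _; rewrite fE in gN.
Qed.

Definition mul_hom : QG -> QG -> QG := bilinear_ext hom_prod.
Definition mul_mono : QG -> QG -> QG := bilinear_ext mono_prod.
Definition mul_regmono : QG -> QG -> QG := bilinear_ext regmono_prod.

Definition unit_QG : QG := << class_of empty_graph >>.

Definition GC_hom (L : graph_class) : QG -> rat :=
  fglift (fun s : graph_class => #|Hom s L|%:R : rat^o).

Definition GC_mono (L : graph_class) : QG -> rat :=
  fglift (fun s : graph_class => #|Mono s L|%:R : rat^o).

Definition GC_regmono (L : graph_class) : QG -> rat :=
  fglift (fun s : graph_class => #|RegMono s L|%:R : rat^o).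

Definition is_character (mul : QG -> QG -> QG) (phi : QG -> rat) : Prop :=
  [/\ scalar phi, phi unit_QG = 1 &
      forall x y : QG, phi x * phi y = phi (mul x y)].

(* Main.v *)
Require Import Defs.

(** A map f on the disjoint union of s1 and s2 whose restrictions are (regular)
    monomorphisms factors through its image, uniquely up to the automorphisms of
    the middle graph: for every graph g, the factorizations f = i o e with e a
    (regular) epimorphism onto g and i a (regular) monomorphism correspond to the
    isomorphisms from g to the image of f, so there are |Aut g| of them when g is
    isomorphic to this image and none otherwise. Weighting by 1 / |Aut g| and
    summing over isomorphism classes, each f counts exactly once. For
    monomorphisms the image carries only the edges coming from the source; the
    counting reduces to the regular case by first removing the other edges from
    the target. *)

Set Implicit Arguments.
Unset Strict Implicit.
Unset Printing Implicit Defensive.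

Import GRing.Theory Num.Theory.
Local Open Scope ring_scope.

(** * Linearity of the extension of a map from the basis to the free module *)

Section FreegLift.
Variables (R : comNzRingType) (K : choiceType) (V : lmodType R).

Lemma fglift0 (f : K -> V) : fglift f (0 : {freeg K / R}) = 0.
(* [lift_is_additive] is compatibility with subtraction; both sides of its instance at [0 - 0]
   collapse. *)
Proof. by have := lift_is_additive f 0 0; rewrite !subrr. Qed.

Lemma fgliftD (f : K -> V) (x y : {freeg K / R}) :
  fglift f (x + y) = fglift f x + fglift f y.
Proof.
have H := lift_is_additive f.
have HN z : fglift f (- z) = - fglift f z.
  by rewrite -[- z]add0r H fglift0 add0r.
by rewrite -{1}[y]opprK H HN opprK.
Qed.

Lemma scale_freegU (c k : R) (x : K) : c *: << k *g x >> = << c * k *g x >>.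
Proof. by apply/eqP/freeg_eqP => z; rewrite coeffZ !coeffU mulrA. Qed.

Lemma fgliftZ (f : K -> V) (c : R) (x : {freeg K / R}) :
  fglift f (c *: x) = c *: fglift f x.
Proof.
elim/freeg_ind_dom0: x => [|k x D _ _ IH]; first by rewrite scaler0 fglift0 scaler0.
by rewrite scalerDr !fgliftD IH scale_freegU !liftU scalerDr scalerA.
Qed.

Lemma fglift_sum (f : K -> V) (I : Type) (r : seq I) (F : I -> {freeg K / R}) :
  fglift f (\sum_(i <- r) F i) = \sum_(i <- r) fglift f (F i).
Proof.
elim: r => [|i r IH]; first by rewrite !big_nil fglift0.
by rewrite !big_cons fgliftD IH.
Qed.

End FreegLift.

(** Both sides of multiplicativity are bilinear, so induction on the formal sums [x] and then [y]
    reduces the claim to pairs of basis elements. *)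
Lemma bilinear_ext_character (m : graph_class -> graph_class -> QG)
    (w : graph_class -> rat^o) :
  w (class_of empty_graph) = 1 ->
  (forall s1 s2, w s1 * w s2 = fglift w (m s1 s2)) ->
  is_character (bilinear_ext m) (fglift w).
Proof.
move=> w1 wM.
have scaleE (c : rat) (z : rat^o) : c *: z = c * z by [].
split.
- by move=> c x y; rewrite fgliftD fgliftZ.
- by rewrite liftU scale1r.
- move=> x y; rewrite /bilinear_ext.
  elim/freeg_ind_dom0: x => [|k s1 D _ _ IH]; first by rewrite !fglift0 mul0r.
  rewrite !fgliftD mulrDl IH; congr (_ + _); rewrite !liftU fgliftZ !scaleE -mulrA.
  congr (_ * _); elim/freeg_ind_dom0: y {IH} => [|l s2 D' _ _ IH].
    by rewrite !fglift0 mulr0.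
  by rewrite !fgliftD mulrDr IH !liftU fgliftZ !scaleE mulrCA wM.
Qed.

(** * Reflection of the classes of maps, and counting of isomorphisms *)

Implicit Types s t : sgraph.

Definition comp (s t u : sgraph) (i : {ffun t -> u}) (e : {ffun s -> t}) : {ffun s -> u} :=
  [ffun x => i (e x)].

Lemma HomP s t (f : {ffun s -> t}) :
  reflect (forall x y, adj x y -> adj (f x) (f y)) (f \in Hom s t).
Proof.
rewrite inE; apply: (iffP forallP) => H x => [y|].
  by move: (H x) => /forallP /(_ y) /implyP.
by apply/forallP => y; apply/implyP/H.
Qed.

Lemma MonoP s t (f : {ffun s -> t}) :
  reflect (f \in Hom s t /\ injective f) (f \in Mono s t).
Proof.
by rewrite [_ \in Mono _ _]in_set; apply: (iffP andP) => -[? /injectiveP].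
Qed.

Lemma RegMonoP s t (f : {ffun s -> t}) :
  reflect ({mono f : x y / adj x y} /\ injective f) (f \in RegMono s t).
Proof.
rewrite RegMonoE; apply: (iffP andP) => [[/injectiveP fi H]|[H fi]]; split=> //.
- by move=> x y; move: H => /forallP /(_ x) /forallP /(_ y) /eqP.
- exact/injectiveP.
- by apply/forallP => x; apply/forallP => y; rewrite H.
Qed.

Lemma vertex_surjectiveP s t (f : {ffun s -> t}) :
  reflect (forall v, exists x, f x = v) (vertex_surjective f).
Proof.
apply: (iffP forallP) => H v; first by case/existsP: (H v) => x /eqP; exists x.
by apply/existsP; case: (H v) => x <-; exists x.
Qed.

Lemma edge_surjectiveP s t (f : {ffun s -> t}) :
  reflect (forall u v, adj u v -> exists x y, [/\ adj x y, f x = u & f y = v])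
          (edge_surjective f).
Proof.
apply: (iffP forallP) => H u => [v uv|].
  move: (H u) => /forallP /(_ v) /implyP /(_ uv) /existsP [x] /existsP [y].
  by case/and3P => xy /eqP <- /eqP <-; exists x, y.
apply/forallP => v; apply/implyP => /H [x [y [xy <- <-]]].
by apply/existsP; exists x; apply/existsP; exists y; rewrite xy !eqxx.
Qed.

Lemma IsoP s t (f : {ffun s -> t}) :
  reflect [/\ injective f, forall v, exists x, f x = v &
              {mono f : x y / adj x y}] (f \in Iso s t).
Proof.
rewrite inE; apply: (iffP and3P).
  case=> /injectiveP fi /vertex_surjectiveP fs H; split=> // x y.
  by move: H => /forallP /(_ x) /forallP /(_ y) /eqP.
case=> fi fs H; split; [exact/injectiveP|exact/vertex_surjectiveP|].
by apply/forallP => x; apply/forallP => y; rewrite H.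
Qed.

Lemma comp_Iso (s t u : sgraph) (f : {ffun s -> t}) (g : {ffun t -> u}) :
  f \in Iso s t -> g \in Iso t u -> comp g f \in Iso s u.
Proof.
move=> /IsoP [fi fs fA] /IsoP [gi gs gA]; apply/IsoP; split.
- by move=> x y; rewrite !ffunE => /gi /fi.
- move=> v; case: (gs v) => y <-; case: (fs y) => x <-.
  by exists x; rewrite ffunE.
- by move=> x y; rewrite !ffunE gA fA.
Qed.

Lemma Iso_inv s t (f : {ffun s -> t}) : f \in Iso s t ->
  exists2 g : {ffun t -> s}, g \in Iso t s & cancel f g /\ cancel g f.
Proof.
case/IsoP => fi fs fA.
have fs' v : exists x, f x == v by case: (fs v) => x <-; exists x.
pose g := [ffun v => xchoose (fs' v)].
have gK : cancel g f by move=> v; rewrite ffunE; apply/eqP/(xchooseP (fs' v)).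
have fK : cancel f g by move=> x; apply: fi; rewrite gK.
exists g => //; apply/IsoP; split; first exact: can_inj gK.
- by move=> x; exists (f x).
- by move=> x y; rewrite -fA !gK.
Qed.

Lemma comp_inj (s t u : sgraph) (j : {ffun t -> u}) :
  injective j -> injective (@comp s t u j).
Proof.
move=> ji a b /ffunP ab; apply/ffunP => x.
by move: (ab x); rewrite !ffunE => /ji.
Qed.

(* Once one isomorphism is fixed, the others form an [Aut s]-torsor. *)
Lemma card_Iso s t : isog s t -> #|Iso s t| = #|Aut s|.
Proof.
case/existsP => j jI; have [j' j'I [jK j'K]] := Iso_inv jI.
rewrite -(card_imset _ (comp_inj (s := s) (can_inj jK))).
apply: eq_card => f; apply/idP/imsetP => [fI|[a aI ->]]; last exact: comp_Iso aI jI.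
exists (comp j' f); first exact: comp_Iso fI j'I.
by apply/ffunP => x; rewrite !ffunE j'K.
Qed.

Lemma card_Aut_gt0 s : (0 < #|Aut s|)%N.
Proof. by case/existsP: (isog_refl s) => f fI; apply/card_gt0P; exists f. Qed.

(** Only the class of [t] admits isomorphisms to [t], and there they are as many as the
    automorphisms. The bound on [#|t|] ensures that this class is listed. *)
Lemma sum_Iso_class (t : sgraph) N : (#|t| <= N)%N ->
  \sum_(g <- classes_upto N) (#|Iso (rep g) t|%:R / #|Aut (rep g)|%:R : rat) = 1.
Proof.
move=> tN; have ct := rep_class_of t.
rewrite (bigD1_seq (class_of t)) ?undup_uniq //=; last first.
  by rewrite mem_classes_upto (isog_card ct).
rewrite (card_Iso ct) divff ?pnatr_eq0 -?lt0n ?card_Aut_gt0 //.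
rewrite big1 ?addr0 // => g gt.
suff -> : #|Iso (rep g) t| = 0%N by rewrite mul0r.
apply/eqP; rewrite -leqn0 leqNgt; apply: contra gt => /card_gt0P [f fI].
rewrite -[g]class_of_rep; apply/eqP/class_ofP.
by apply/existsP; exists f.
Qed.

(** * Factorizations of a map through a middle graph *)

Section Factorizations.
Variables (s g t : sgraph).

Definition factorizations (E : {set {ffun s -> g}}) (M : {set {ffun g -> t}})
    (f : {ffun s -> t}) : {set {ffun s -> g} * {ffun g -> t}} :=
  [set p | [&& p.1 \in E, p.2 \in M & comp p.2 p.1 == f]].

Lemma factorizationsP (E : {set _}) (M : {set _}) f (p : {ffun s -> g} * {ffun g -> t}) :
  reflect [/\ p.1 \in E, p.2 \in M & comp p.2 p.1 = f]
          (p \in factorizations E M f).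
Proof. by rewrite inE; apply: (iffP and3P) => -[? ? /eqP]. Qed.

(* Both sides count the embeddings of [g] with image [f @: s]: the surjection
   is determined by the embedding. *)
Lemma card_factorizations_reg (f : {ffun s -> t}) : f \in Hom s t ->
  #|factorizations (Epi s g) (RegMono g t) f| =
  #|Iso g (induced (f @: [set: s]))|.
Proof.
move=> /HomP fH; set H := induced _.
pose emb (j : {ffun g -> H}) : {ffun g -> t} := [ffun x => val (j x)].
have emb_inj : injective emb.
  move=> a b /ffunP ab; apply/ffunP => x.
  by apply: val_inj; move: (ab x); rewrite !ffunE.
rewrite -(card_imset _ emb_inj).
rewrite -(@card_in_imset _ _ (@snd _ _)); last first.
  move=> [e i] [e' i'] /factorizationsP [/= _ /RegMonoP [_ ii] ef].
  move=> /factorizationsP [/= _ _ ef'] i_eq; congr pair => //.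
  by apply: (comp_inj ii); rewrite ef -ef' i_eq.
apply: eq_card => i; apply/imsetP/imsetP.
- case=> -[e i'] /factorizationsP [/= eE iM ef] -> {i}.
  case/RegMonoP: iM => iA ii.
  have es : forall v, exists x, e x = v.
    by move: eE; rewrite inE => /andP [_ /vertex_surjectiveP].
  have iE x : f x = i' (e x) by rewrite -ef ffunE.
  (* Since [e] is surjective, [i'] and [f] have the same image, so [i'] corestricts to an
     isomorphism onto [H]. *)
  have im v : i' v \in f @: [set: s].
    by case: (es v) => x <-; rewrite -iE imset_f.
  pose j : {ffun g -> H} := [ffun v => exist _ (i' v) (im v)].
  exists j; last by apply/ffunP => v; rewrite !ffunE.
  apply/(IsoP j); split.
  + by move=> x y; rewrite !ffunE => -[] /ii.
  + case=> v vI; case/imsetP: (vI) => x _ vE; exists (e x).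
    by rewrite ffunE; apply: val_inj; rewrite /= -iE.
  + by move=> x y; rewrite !ffunE /= /induced_adj /= iA.
- case=> j /IsoP [ji js jA] ->.
  have jE v : exists x, j x == v by case: (js v) => x <-; exists x.
  have fI x : f x \in f @: [set: s] by rewrite imset_f.
  (* The surjection is forced: [e x] has to be the preimage of [f x] under [j]. *)
  pose e := [ffun x => xchoose (jE (exist _ (f x) (fI x)))].
  have je x : j (e x) = exist _ (f x) (fI x).
    by rewrite ffunE; apply/eqP/(xchooseP (jE _)).
  exists (e, emb j) => //; apply/factorizationsP; split=> /=.
  + rewrite inE; apply/andP; split.
      by apply/HomP => x y xy; rewrite -jA !je /= /induced_adj /= fH.
    apply/vertex_surjectiveP => v; have [[u uI] jv] : exists w, j v = w by exists (j v).
    case/imsetP: (uI) => x _ ux; exists x; apply: ji; rewrite je jv.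
    exact: val_inj.
  + apply/RegMonoP; split; first by move=> x y; rewrite !ffunE -jA.
    by move=> x y; rewrite !ffunE => /val_inj /ji.
  + by apply/ffunP => x; rewrite ffunE [LHS]ffunE je.
Qed.

End Factorizations.

(** * Reduction of monomorphisms to regular monomorphisms *)

Section EdgeImage.
Variables (s t : sgraph) (f : {ffun s -> t}).
Hypothesis fH : f \in Hom s t.

Definition edge_image_adj : rel t :=
  fun u v => [exists x, exists y, [&& adj x y, f x == u & f y == v]].

Lemma edge_image_adjP u v :
  reflect (exists x y, [/\ adj x y, f x = u & f y = v]) (edge_image_adj u v).
Proof.
apply: (iffP existsP) => [[x /existsP [y /and3P [xy /eqP <- /eqP <-]]]|].
  by exists x, y.
by case=> x [y [xy <- <-]]; exists x; apply/existsP; exists y; rewrite xy !eqxx.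
Qed.

Lemma edge_image_sym : symmetric edge_image_adj.
Proof.
move=> u v; apply/edge_image_adjP/edge_image_adjP => -[x [y [xy <- <-]]];
by exists y, x; rewrite adj_sym.
Qed.

Lemma edge_image_irr : irreflexive edge_image_adj.
Proof.
move=> u; apply/edge_image_adjP => -[x [y [xy xu yu]]].
by have /HomP /(_ _ _ xy) := fH; rewrite xu yu adj_irr.
Qed.

(* Keeps all the vertices of [t], so that maps into [t] and into this graph
   have the same type. *)
Definition edge_image : sgraph := SGraph edge_image_sym edge_image_irr.

(** The edges of [edge_image] are the images of edges of [s]. Given [f = i o e] with [i] injective,
    [i] reflects these edges because [e] preserves adjacency, and it sends all edges of [g] to such
    edges exactly when [e] is surjective on edges. *)
Lemma factorizations_mono (g : sgraph) :
  factorizations (RegEpi s g) (Mono g t) f =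
  factorizations (Epi s g) (RegMono g edge_image) (f : {ffun s -> edge_image}).
Proof.
apply/setP => -[e i]; apply/factorizationsP/factorizationsP => /= -[].
- rewrite inE => /andP [eE /edge_surjectiveP ee] /MonoP [/HomP iH ii] ef.
  split=> //; apply/(@RegMonoP g edge_image i); split=> // u v; apply/edge_image_adjP/idP.
    have eH : e \in Hom s g by move: eE; rewrite inE => /andP [].
    case=> x [y [xy]]; rewrite -ef !ffunE => /ii <- /ii <-.
    exact: (HomP _ eH).
  by case/ee => x [y [xy <- <-]]; exists x, y; rewrite -ef !ffunE.
- move=> eE /(@RegMonoP g edge_image i) [iA ii] ef; split=> //.
    rewrite inE eE; apply/edge_surjectiveP => u v; rewrite -iA.
    case/edge_image_adjP => x [y [xy xu yv]]; exists x, y; split=> //; apply: ii.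
      by rewrite -xu -ef ffunE.
    by rewrite -yv -ef ffunE.
  apply/MonoP; split=> //; apply/HomP => u v; rewrite -iA.
  by case/edge_image_adjP => x [y [xy <- <-]]; apply: (HomP _ fH).
Qed.

End EdgeImage.

(** * Maps out of a disjoint union *)

Section Union.
Variables s1 s2 : sgraph.
Notation U := (disjoint_union s1 s2).

Definition union_maps t (A : {set {ffun s1 -> t}}) (B : {set {ffun s2 -> t}}) :
    {set {ffun U -> t}} :=
  [set f | (restrl f \in A) && (restrr f \in B)].

Lemma in_union_maps t (A : {set {ffun s1 -> t}}) (B : {set {ffun s2 -> t}}) f :
  (f \in union_maps A B) = (restrl f \in A) && (restrr f \in B).
Proof. by rewrite in_set. Qed.

(** A map on the disjoint union amounts to an independent choice of its two restrictions. *)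
Lemma card_union_maps t (A : {set {ffun s1 -> t}}) (B : {set {ffun s2 -> t}}) :
  #|union_maps A B| = (#|A| * #|B|)%N.
Proof.
rewrite -cardsX -[LHS](@card_imset _ _ (fun f => (restrl f, restrr f))); last first.
  move=> f g [/ffunP l /ffunP r]; apply/ffunP => -[] x.
    by move: (l x); rewrite !ffunE.
  by move: (r x); rewrite !ffunE.
apply: eq_card => -[a b]; rewrite in_setX /=; apply/imsetP/andP.
  by case=> f; rewrite inE => /andP [? ?] [-> ->].
case=> aA bB; pose f : {ffun U -> t} :=
  [ffun x => match x with inl y => a y | inr y => b y end].
have fl : restrl f = a by apply/ffunP => x; rewrite !ffunE.
have fr : restrr f = b by apply/ffunP => x; rewrite !ffunE.
by exists f; rewrite ?inE ?fl ?fr ?aA.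
Qed.

(** No edge joins the two summands, so adjacency is tested on each restriction separately. *)
Lemma Hom_union t : Hom U t = union_maps (Hom s1 t) (Hom s2 t).
Proof.
apply/setP => f; rewrite in_union_maps; apply/HomP/andP => [H|[/HomP H1 /HomP H2]].
  by split; apply/HomP => x y xy; rewrite !ffunE; apply: H.
case=> x [] y //= xy.
  by move: (H1 _ _ xy); rewrite !ffunE.
by move: (H2 _ _ xy); rewrite !ffunE.
Qed.

Lemma union_mapsS t (A A' : {set {ffun s1 -> t}}) (B B' : {set {ffun s2 -> t}}) :
  A \subset A' -> B \subset B' -> union_maps A B \subset union_maps A' B'.
Proof.
move=> /subsetP AA /subsetP BB; apply/subsetP => f; rewrite !in_union_maps.
by case/andP => /AA -> /BB ->.
Qed.

Lemma restrl_comp (g t : sgraph) (i : {ffun g -> t}) (e : {ffun U -> g}) :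
  restrl (comp i e) = comp i (restrl e).
Proof. by apply/ffunP => x; rewrite !ffunE. Qed.

Lemma restrr_comp (g t : sgraph) (i : {ffun g -> t}) (e : {ffun U -> g}) :
  restrr (comp i e) = comp i (restrr e).
Proof. by apply/ffunP => x; rewrite !ffunE. Qed.

(* Double counting of the pairs [(e, i)] by their composite. *)
Lemma card_prod_factorizations (g t : sgraph) (E : {set {ffun U -> g}})
    (M : {set {ffun g -> t}}) (A : {set {ffun s1 -> g}}) (B : {set {ffun s2 -> g}})
    (A' : {set {ffun s1 -> t}}) (B' : {set {ffun s2 -> t}}) :
  {in E & M, forall e i, (e \in union_maps A B) = (comp i e \in union_maps A' B')} ->
  (#|E :&: union_maps A B| * #|M| =
   \sum_(f in union_maps A' B') #|factorizations E M f|)%N.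
Proof.
move=> H; rewrite -cardsX -sum1_card.
rewrite (partition_big (fun p => comp p.2 p.1) (mem (union_maps A' B'))) /=; last first.
  move=> [e i]; rewrite in_setX /= => /andP [/setIP [eE eA] iM].
  by rewrite -(H e i).
apply: eq_bigr => f fA; rewrite -sum1_card; apply: eq_bigl => -[e i].
rewrite [RHS]in_set; apply/andP/and3P => /= -[].
- by rewrite in_setX => /andP [/setIP [eE _] iM].
- move=> eE iM ef; split=> //.
  by rewrite in_setX in_setI eE iM (H e i) // (eqP ef) fA.
Qed.

End Union.

(** * Multiplicativity on basis elements for monomorphisms and regular monomorphisms *)

(** A monomorphism [i] may create adjacencies, so [e \in Hom s t] is assumed rather than deduced
    from the composite. *)
Lemma comp_Mono (s t u : sgraph) (i : {ffun t -> u}) (e : {ffun s -> t}) :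
  i \in Mono t u -> e \in Hom s t -> (comp i e \in Mono s u) = (e \in Mono s t).
Proof.
case/MonoP => /HomP iH ii eH; apply/MonoP/MonoP => -[H ei]; split=> //.
- by move=> x y xy; apply: ei; rewrite !ffunE xy.
- by apply/HomP => x y xy; rewrite !ffunE; apply/iH/(HomP _ eH).
- by move=> x y; rewrite !ffunE => /ii /ei.
Qed.

(** Here [i] also reflects adjacency, so the behaviour of [e] on edges can be read off from the
    composite. *)
Lemma comp_RegMono (s t u : sgraph) (i : {ffun t -> u}) (e : {ffun s -> t}) :
  i \in RegMono t u -> (comp i e \in RegMono s u) = (e \in RegMono s t).
Proof.
case/RegMonoP => iA ii; apply/RegMonoP/RegMonoP => -[H ei]; split.
- by move=> x y; rewrite -H !ffunE iA.
- by move=> x y xy; apply: ei; rewrite !ffunE xy.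
- by move=> x y; rewrite !ffunE iA H.
- by move=> x y; rewrite !ffunE => /ii /ei.
Qed.

(** Common core of the two cases: [E] is the class of epimorphisms, [Q] that of monomorphisms, and
    [t] plays the image of [f]. *)
Lemma sum_factorizations (E Q : forall s t, {set {ffun s -> t}}) (s1 s2 L : sgraph) :
  let U := disjoint_union s1 s2 in
  (forall g, {in E U g & Q g L, forall e i,
     (e \in union_maps (Q s1 g) (Q s2 g)) =
     (comp i e \in union_maps (Q s1 L) (Q s2 L))}) ->
  {in union_maps (Q s1 L) (Q s2 L), forall f, exists2 t : sgraph, (#|t| <= #|U|)%N &
     forall g, #|factorizations (E U g) (Q g L) f| = #|Iso g t|} ->
  \sum_(g <- classes_upto (#|s1| + #|s2|))
     (#|[set f in E U (rep g) |
          (restrl f \in Q s1 (rep g)) && (restrr f \in Q s2 (rep g))]|%:R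
       / #|Aut (rep g)|%:R) * #|Q (rep g) L|%:R
  = #|Q s1 L|%:R * #|Q s2 L|%:R :> rat.
Proof.
move=> U compat fact; rewrite -natrM -card_union_maps -sum1_card natr_sum.
under [RHS]eq_bigr => f fA.
  case: (fact f fA) => t tU ft; rewrite card_sum in tU.
  (* The contribution 1 of [f] is spread over the classes [g], in proportion to its factorizations
     through [g]; exchanging the sums then permits double counting for each [g]. *)
  rewrite -(sum_Iso_class tU); under eq_bigr do rewrite -ft.
  over.
rewrite exchange_big /=; apply: eq_bigr => g _.
rewrite mulrAC -natrM -mulr_suml -natr_sum.
rewrite -(card_prod_factorizations (compat (rep g))).
by congr ((_ * _)%N%:R / _); apply: eq_card => f; rewrite !inE.
Qed.

Lemma card_induced_imset s t (f : {ffun s -> t}) :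
  (#|induced (f @: [set: s])| <= #|s|)%N.
Proof. by rewrite card_sig -[X in (_ <= X)%N]cardsT leq_imset_card. Qed.

Lemma GC_mono_basis (s1 s2 L : graph_class) :
  (#|Mono s1 L|%:R : rat) * #|Mono s2 L|%:R = GC_mono L (mono_prod s1 s2).
Proof.
rewrite /GC_mono /mono_prod fglift_sum -(@sum_factorizations RegEpi Mono).
- by apply: eq_bigr => g _; rewrite liftU.
- move=> g e i eE iM; have eH : e \in union_maps (Hom s1 g) (Hom s2 g).
    by rewrite -Hom_union; move: eE; rewrite !inE -!andbA => /andP [].
  move: eH; rewrite !in_union_maps => /andP [eHl eHr].
  by rewrite restrl_comp restrr_comp !comp_Mono.
- move=> f fM; have MH s : Mono s L \subset Hom s L.
    by apply/subsetP => h /MonoP [].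
  have fH : f \in Hom (disjoint_union s1 s2) L.
    by rewrite Hom_union; apply: subsetP fM; apply: union_mapsS.
  (* The image here has the vertices hit by [f] and only the edges coming from the source. *)
  exists (@induced (edge_image fH) (f @: setT)).
    exact: (@card_induced_imset _ (edge_image fH)).
  move=> g; rewrite (factorizations_mono fH).
  apply: (@card_factorizations_reg _ g (edge_image fH) f).
  (* By construction of [edge_image], [f] remains a homomorphism when it is the target. *)
  by apply/(@HomP _ (edge_image fH) f) => x y xy; apply/edge_image_adjP; exists x, y.
Qed.

Lemma GC_regmono_basis (s1 s2 L : graph_class) :
  (#|RegMono s1 L|%:R : rat) * #|RegMono s2 L|%:R =
  GC_regmono L (regmono_prod s1 s2).
Proof.
rewrite /GC_regmono /regmono_prod fglift_sum -(@sum_factorizations Epi RegMono).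
- by apply: eq_bigr => g _; rewrite liftU.
- move=> g e i _ iM.
  by rewrite !in_union_maps restrl_comp restrr_comp !comp_RegMono.
- move=> f fM; have MH s : RegMono s L \subset Hom s L.
    by apply/subsetP => h /RegMonoP [hA _]; apply/HomP => x y; rewrite hA.
  have fH : f \in Hom (disjoint_union s1 s2) L.
    by rewrite Hom_union; apply: subsetP fM; apply: union_mapsS.
  exists (induced (f @: setT)); first exact: card_induced_imset.
  by move=> g; rewrite card_factorizations_reg.
Qed.

(** * The homomorphism case and the unit *)

(** Precomposition with an isomorphism is injective on homomorphisms. This allows the representative
    chosen by [class_of] to be replaced by the disjoint union itself. *)
Lemma card_Hom_isog s s' t : isog s s' -> #|Hom s t| = #|Hom s' t|.
Proof.
suff le a b : isog a b -> (#|Hom b t| <= #|Hom a t|)%N.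
  by move=> st; apply/eqP; rewrite eqn_leq !le // isog_sym.
case/existsP => j /IsoP [_ js jA].
rewrite -(@card_in_imset _ _ (fun f => comp f j)) => [|f g _ _ /ffunP fg].
  apply/subset_leq_card/subsetP => _ /imsetP [f /HomP fH ->].
  by apply/HomP => x y xy; rewrite !ffunE fH // jA.
apply/ffunP => v; case: (js v) => x <-; have := fg x.
by rewrite !ffunE.
Qed.

Lemma GC_hom_basis (s1 s2 L : graph_class) :
  (#|Hom s1 L|%:R : rat) * #|Hom s2 L|%:R = GC_hom L (hom_prod s1 s2).
Proof.
rewrite /GC_hom liftU scale1r (card_Hom_isog _ (rep_class_of _)).
by rewrite Hom_union card_union_maps natrM.
Qed.

Lemma card_ffun_empty s t (A : {set {ffun s -> t}}) :
  #|s| = 0%N -> (forall f, f \in A) -> #|A| = 1%N.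
Proof.
by move=> s0 AT; rewrite (eq_card (B := predT)) ?card_ffun ?s0 ?expn0 //.
Qed.

Theorem theorem3p15 (L : graph_class) :
  [/\ is_character mul_hom (GC_hom L),
      is_character mul_mono (GC_mono L) &
      is_character mul_regmono (GC_regmono L)].
Proof.
(* The representative of the unit class is only isomorphic to [empty_graph], so its emptiness is
   obtained through its cardinality. *)
have e0 : #|class_of empty_graph| = 0%N.
  by rewrite (isog_card (rep_class_of _)) card_void.
have eF (x : class_of empty_graph) : False by have := card0_eq e0 x.
split; apply: bilinear_ext_character.
- by rewrite card_ffun_empty // => f; apply/HomP => x; case: (eF x).
- by move=> s1 s2; apply: GC_hom_basis.
- rewrite card_ffun_empty // => f; apply/MonoP; split; last by move=> x; case: (eF x).
  by apply/HomP => x; case: (eF x).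
- by move=> s1 s2; apply: GC_mono_basis.
- by rewrite card_ffun_empty // => f; apply/RegMonoP; split=> x; case: (eF x).
- by move=> s1 s2; apply: GC_regmono_basis.
Qed.
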